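(* Let $\bar G$ be a finite group which does not satisfy the $(\mu,\lambda)$-property, and let $G$ be a finite group which is an extension of $\bar G$, in the sense that $G$ has a normal subgroup $N$ with $G/N\cong\bar G$. Then $G$ does not satisfy the $(\mu,\lambda)$-property.
   Context: For a finite poset $\mathcal{P}$, the Möbius function $\mu_{\mathcal{P}}:\mathcal{P}\times\mathcal{P}\to\mathbb{Z}$ is defined by $\mu_{\mathcal{P}}(x,y)=0$ if $x\not\leq y$, $\mu_{\mathcal{P}}(x,x)=1$, and $\mu_{\mathcal{P}}(x,y)=-\sum_{x<z\leq y}\mu_{\mathcal{P}}(z,y)$ if $x<y$. For a finite group $G$, let $\mathcal{L}$ be the lattice of all subgroups of $G$ ordered by inclusion, and let $\mathcal{C}$ be the poset of conjugacy classes $[H]$ of subgroups $H\leq G$, ordered by $[H]\leq[K]$ if and only if $H\leq K^g$ for some $g\in G$. For $H\leq G$ put $\mu(H)=\mu_{\mathcal{L}}(H,G)$ and $\lambda(H)=\mu_{\mathcal{C}}([H],[G])$. $G'$ is the derived (commutator) subgroup of $G$, and $N_{G'}(H)=\{g\in G' : H^g=H\}$. The group $G$ satisfies the $(\mu,\lambda)$-property if $\mu(H)=[N_{G'}(H):G'\cap H]\cdot\lambda(H)$ for every $H\leq G$. *)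

(* Defs.v *)
From HB Require Import structures.
From mathcomp Require Import all_boot all_order all_algebra all_fingroup all_solvable.

Set Implicit Arguments.
Unset Strict Implicit.
Unset Printing Implicit Defensive.

Import Order.TTheory GRing.Theory.

Section Mobius.
Local Open Scope ring_scope.

Variables (d : Order.disp_t) (P : finPOrderType d).
Implicit Types x y z : P.

(* The recursion is on a fuel n, since the defining recursion of the Möbius
   function is well founded but not structural; #|P| steps are always enough,
   as the lemmas below show that [mobius] satisfies its defining equations. *)
Fixpoint mobius_rec (n : nat) (x y : P) : int :=
  if n is n'.+1 then
    if x == y then 1
    else if (x < y)%O then - \sum_(z : P | (x < z <= y)%O) mobius_rec n' z y
    else 0
  else 0.

Definition mobius (x y : P) : int := mobius_rec #|P| x y.

Lemma mobius_rec_fuel n m x y :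
  (#|[set z : P | (x <= z)%O]| <= n)%N -> (#|[set z : P | (x <= z)%O]| <= m)%N ->
  mobius_rec n x y = mobius_rec m x y.
Proof.
have pos u : (0 < #|[set z : P | (u <= z)%O]|)%N.
  by apply/card_gt0P; exists u; rewrite inE lexx.
elim: n m x => [|n IHn] m x le_n le_m; first by have := pos x; rewrite ltnNge le_n.
case: m le_m => [|m] le_m; first by have := pos x; rewrite ltnNge le_m.
rewrite /=; case: (x == y) => //; case: (x < y)%O => //.
congr (- _); apply: eq_bigr => z /andP[ltxz _].
have lt_card : (#|[set w : P | (z <= w)%O]| < #|[set w : P | (x <= w)%O]|)%N.
  apply: proper_card; apply/properP; split.
    by apply/subsetP=> w; rewrite !inE; apply: le_trans (ltW ltxz).
  by exists x; rewrite inE ?lexx ?(lt_geF ltxz).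
by apply: IHn; rewrite -ltnS; apply: leq_trans lt_card _.
Qed.

Lemma mobiusE x y :
  mobius x y =
    if x == y then 1
    else if (x < y)%O then - \sum_(z : P | (x < z <= y)%O) mobius z y
    else 0.
Proof.
rewrite /mobius (@mobius_rec_fuel _ #|P|.+1) ?max_card //.
exact: leqW (max_card _).
Qed.

Lemma mobius_nle x y : ~~ (x <= y)%O -> mobius x y = 0.
Proof.
move=> nle; rewrite mobiusE; case: eqP => [eq_xy|_].
  by rewrite eq_xy lexx in nle.
by case: ifP => // /ltW lexy; rewrite lexy in nle.
Qed.

Lemma mobiusxx x : mobius x x = 1.
Proof. by rewrite mobiusE eqxx. Qed.

Lemma mobius_lt x y :
  (x < y)%O -> mobius x y = - \sum_(z : P | (x < z <= y)%O) mobius z y.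
Proof. by move=> ltxy; rewrite mobiusE lt_eqF // ltxy. Qed.

End Mobius.

Section SubgroupLattice.
Variables (gT : finGroupType) (G : {group gT}).

Record subgroup_of := SubgroupOf {
  subgroup_val :> {group gT};
  subgroup_sub : subgroup_val \subset G
}.

HB.instance Definition _ := [isSub for subgroup_val].
HB.instance Definition _ := [Finite of subgroup_of by <:].

Definition subgroup_le (H K : subgroup_of) : bool := H \subset K.

Lemma subgroup_le_refl : reflexive subgroup_le.
Proof. by move=> H; apply: subxx. Qed.

Lemma subgroup_le_anti : antisymmetric subgroup_le.
Proof.
move=> H K sHKH; apply/val_inj/group_inj/eqP.
by rewrite eqEsubset; exact: sHKH.
Qed.

Lemma subgroup_le_trans : transitive subgroup_le.
Proof. by move=> K H L; apply: subset_trans. Qed.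

HB.instance Definition _ := Order.Le_isPOrder.Build
  (Order.Disp tt tt) subgroup_of
  subgroup_le_refl subgroup_le_anti subgroup_le_trans.

Definition subgroup_top : subgroup_of := SubgroupOf (subxx G).

End SubgroupLattice.

Section SubgroupClasses.
Local Open Scope group_scope.
Variables (gT : finGroupType) (G : {group gT}).
Implicit Types H K : subgroup_of G.

Record subgroup_class := SubgroupClass {
  class_val :> {set {group gT}};
  class_valP : class_val \in [set orbit 'JG G H | H : {group gT} in subgroups G]
}.

HB.instance Definition _ := [isSub for class_val].
HB.instance Definition _ := [Finite of subgroup_class by <:].

Fact class_of_subproof H :
  orbit 'JG G (H : {group gT})
    \in [set orbit 'JG G K | K : {group gT} in subgroups G].
Proof. by apply/imsetP; exists (H : {group gT}); rewrite ?inE ?subgroup_sub. Qed.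

Definition class_of H : subgroup_class := SubgroupClass (class_of_subproof H).

Lemma class_ofP (X : subgroup_class) : exists H, X = class_of H.
Proof.
case: X => X XP; have /imsetP[H] := XP; rewrite inE => sHG defX.
by exists (SubgroupOf sHG); apply: val_inj.
Qed.

(* Independence of the representatives H and K is [class_of_le] below. *)
Definition class_le (X Y : subgroup_class) : bool :=
  [exists H : {group gT} in class_val X, exists K : {group gT} in class_val Y,
    exists g in G, H \subset K :^ g].

Lemma class_leE H K :
  class_le (class_of H) (class_of K) = [exists g in G, H \subset K :^ g].
Proof.
apply/existsP/existsP => [[H1 /andP[]] | [g /andP[Gg sHK]]].
  case/orbitP=> a Ga <- /existsP[K1 /andP[/orbitP[b Gb <-]]].
  case/existsP=> g /andP[Gg sHK]; exists (b * g * a^-1).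
  rewrite !groupM ?groupV //= !conjsgM -sub_conjg; exact: sHK.
exists (subgroup_val H); rewrite orbit_refl; apply/existsP.
exists (subgroup_val K); rewrite orbit_refl.
by apply/existsP; exists g; rewrite Gg.
Qed.

Lemma class_le_refl : reflexive class_le.
Proof.
move=> X; have [H ->] := class_ofP X; rewrite class_leE.
by apply/existsP; exists 1%g; rewrite group1 conjsg1 /=.
Qed.

Lemma class_le_anti : antisymmetric class_le.
Proof.
move=> X Y; have [H ->] := class_ofP X; have [K ->] := class_ofP Y.
rewrite !class_leE => /andP[/existsP[g /andP[Gg sHK]] /existsP[h /andP[_ sKH]]].
have defH : H = (K :^ g)%G :> {group gT}.
  apply/group_inj/eqP; rewrite eqEcard sHK cardJg -(cardJg H h).
  exact: subset_leq_card sKH.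
apply: val_inj; rewrite /= defH; apply/esym/orbit_eqP.
by rewrite orbit_sym; apply/orbitP; exists g.
Qed.

Lemma class_le_trans : transitive class_le.
Proof.
move=> Y X Z; have [K ->] := class_ofP Y; have [H ->] := class_ofP X.
have [L ->] := class_ofP Z; rewrite !class_leE.
case/existsP=> g /andP[Gg sHK] /existsP[h /andP[Gh sKL]].
apply/existsP; exists (h * g)%g; rewrite groupM //= conjsgM.
by apply: subset_trans sHK _; rewrite conjSg.
Qed.

HB.instance Definition _ := Order.Le_isPOrder.Build
  (Order.Disp tt tt) subgroup_class
  class_le_refl class_le_anti class_le_trans.

Lemma class_of_le H K :
  (class_of H <= class_of K)%O = [exists g in G, H \subset K :^ g].
Proof. exact: class_leE. Qed.

End SubgroupClasses.

Section MuLambda.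
Variables (gT : finGroupType) (G : {group gT}).

Definition group_mu (H : subgroup_of G) : int := mobius H (subgroup_top G).

Definition group_lambda (H : subgroup_of G) : int :=
  mobius (class_of H) (class_of (subgroup_top G)).

Definition mu_lambda_property : Prop :=
  forall H : subgroup_of G,
    group_mu H
    = ((#|'N_(G^`(1))(H) : G^`(1) :&: H|)%g%:R * group_lambda H)%R.

End MuLambda.

(* Main.v *)
Require Import Defs.
From mathcomp Require Import all_boot all_order all_algebra all_fingroup all_solvable.

(** The contrapositive holds because every term of the [(mu, lambda)] identity
    for a homomorphic image [Gbar = f @* G] already occurs in the identity
    for [G], at a full preimage.  Taking preimages [K |-> f @*^-1 K] embeds the
    subgroups of [Gbar] onto the subgroups of [G] that contain ['ker f], an
    upward closed set; the same holds for conjugacy classes, because the kernel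
    is normal, so that a subgroup contains it as soon as one of its conjugates
    does.  A value of the Möbius function depends only on what lies above its
    first argument, hence it is preserved by such an embedding
    ([mobius_up_embedding]), and so [mu] and [lambda] take the same values at
    [K] and at its preimage [H] ([group_mu_preim], [group_lambda_preim]).
    As for the index, [f] maps ['N_(G^`(1))(H)] and [G^`(1) :&: H] onto their
    analogues for [K], and these two groups have the same intersection with
    the kernel, since the kernel lies in [H] ([index_norm_der_preim]). *)

Set Implicit Arguments.
Unset Strict Implicit.
Unset Printing Implicit Defensive.

Import Order.TTheory GRing.Theory.

(** The defining recursion at [e x] sums over elements above [e x]; all of
    them lie in the image of [e], so it is the recursion at [x]. *)
Lemma mobius_up_embedding (d d' : Order.disp_t)
    (P : finPOrderType d) (Q : finPOrderType d') (e : P -> Q) :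
  (forall x y, (e x <= e y)%O = (x <= y)%O) ->
  (forall x z, (e x <= z)%O -> exists y, z = e y) ->
  forall x y, mobius (e x) (e y) = mobius x y.
Proof.
move=> e_le e_up.
have e_inj : injective e.
  by move=> x y exy; apply/le_anti; rewrite -!e_le exy lexx.
have e_lt x y : (e x < e y)%O = (x < y)%O by rewrite !lt_neqAle e_le inj_eq.
move=> x y; have [n] := ubnP #|[set z : P | (x <= z)%O]|.
elim: n x => // n IHn x le_x_n.
rewrite [LHS]mobiusE [RHS]mobiusE inj_eq // e_lt; congr (if _ then _ else _).
case: ifP => // _; congr (- _)%R.
transitivity (\sum_(w in e @: [set z | (x < z <= y)%O]) mobius w (e y))%R.
  apply: eq_bigl => w; apply/idP/imsetP => [lt_w | [z + ->]].
    have [/ltW/e_up[z defw] _] := andP lt_w.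
    by exists z; rewrite // inE -e_lt -e_le -defw.
  by rewrite inE e_lt e_le.
rewrite big_imset /=; last by move=> z1 z2 _ _; apply: e_inj.
apply: eq_big => [z | z]; rewrite inE // => /andP[ltxz _].
apply: IHn; rewrite -ltnS; apply: leq_trans le_x_n; rewrite ltnS.
apply: proper_card; apply/properP; split.
  by apply/subsetP=> w; rewrite !inE; apply: le_trans (ltW ltxz).
by exists x; rewrite inE ?lexx ?(lt_geF ltxz).
Qed.

Section HomomorphicImage.
Local Open Scope group_scope.

Variables (gT rT : finGroupType) (G : {group gT}) (Gbar : {group rT}).
Variables (f : {morphism G >-> rT}) (fG : f @* G = Gbar).
Implicit Types (K L : subgroup_of Gbar) (H : subgroup_of G).

Definition preim_subgroup K : subgroup_of G :=
  SubgroupOf (subgroup_val := (f @*^-1 K)%G) (subsetIl G (f @^-1: K)).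

Lemma preim_subgroupE K : preim_subgroup K = f @*^-1 K :> {set gT}.
Proof. by []. Qed.

Lemma sub_image_subgroup K : K \subset f @* G.
Proof. by rewrite fG subgroup_sub. Qed.

Lemma preim_subgroup_sub K L :
  (preim_subgroup K \subset preim_subgroup L) = (K \subset L).
Proof. by rewrite !preim_subgroupE morphpreSK // sub_image_subgroup. Qed.

Lemma ker_sub_preim_subgroup K : 'ker f \subset preim_subgroup K.
Proof. exact: ker_sub_pre. Qed.

(** The correspondence theorem: the preimages are exactly the subgroups above
    the kernel. *)
Lemma preim_subgroup_onto H : 'ker f \subset H -> exists K, H = preim_subgroup K.
Proof.
move=> kerH; have sHG := subgroup_sub H.
have sfH : f @* H \subset Gbar by rewrite -fG morphimS.
exists (SubgroupOf (subgroup_val := (f @* H)%G) sfH).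
by apply/val_inj/group_inj; rewrite /= morphimGK.
Qed.

Lemma preim_subgroup_top : preim_subgroup (subgroup_top Gbar) = subgroup_top G.
Proof.
by apply/val_inj/group_inj; rewrite /= -fG morphimGK ?subsetIl.
Qed.

Lemma group_mu_preim K : group_mu (preim_subgroup K) = group_mu K.
Proof.
rewrite /group_mu -preim_subgroup_top; apply: mobius_up_embedding.
  exact: preim_subgroup_sub.
move=> {}K H sKH; apply: preim_subgroup_onto.
exact: subset_trans (ker_sub_preim_subgroup K) sKH.
Qed.

(** [f] is onto [Gbar], so every conjugating element of [Gbar] lifts to [G], and
    preimages turn conjugation by [f g] into conjugation by [g]. *)
Lemma class_of_preim_le K L :
  (class_of (preim_subgroup K) <= class_of (preim_subgroup L))%O
    = (class_of K <= class_of L)%O.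
Proof.
rewrite !class_of_le; apply/existsP/existsP=> [[g] | [b]] /andP[].
  move=> Gg; rewrite -morphpreJ // morphpreSK ?sub_image_subgroup // => sKL.
  by exists (f g); rewrite sKL -fG mem_morphim.
rewrite -fG => /morphimP[g _ Gg ->] sKL; exists g.
by rewrite Gg -morphpreJ // morphpreS.
Qed.

(** The preimage map on classes is defined through a choice of representative;
    [preim_class_of] shows that the choice does not matter. *)
Definition class_rep (X : subgroup_class Gbar) : subgroup_of Gbar :=
  odflt (subgroup_top Gbar) [pick K | X == class_of K].

Lemma class_repK : cancel class_rep (@class_of rT Gbar).
Proof.
move=> X; rewrite /class_rep; case: pickP => [K /eqP-> // | noK].
by have [K defX] := class_ofP X; have := noK K; rewrite defX eqxx.
Qed.

Definition preim_class (X : subgroup_class Gbar) : subgroup_class G :=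
  class_of (preim_subgroup (class_rep X)).

Lemma preim_class_of K : preim_class (class_of K) = class_of (preim_subgroup K).
Proof. by apply: le_anti; rewrite !class_of_preim_le class_repK !lexx. Qed.

Lemma group_lambda_preim K : group_lambda (preim_subgroup K) = group_lambda K.
Proof.
rewrite /group_lambda -preim_subgroup_top -!preim_class_of.
apply: mobius_up_embedding => [X Y | X Z].
  by rewrite class_of_preim_le !class_repK.
have [H ->] := class_ofP Z; rewrite class_of_le => /existsP[g /andP[Gg sXHg]].
have [|L ->] := @preim_subgroup_onto H; last first.
  by exists (class_of L); rewrite preim_class_of.
(* The kernel is normal, so a subgroup contains it when a conjugate does. *)
have /normsP/(_ g Gg) kerg := ker_norm f.
rewrite -(conjSg _ _ g) kerg.
exact: subset_trans (ker_sub_preim_subgroup _) sXHg.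
Qed.

(** An element of [Gbar^`(1)] lifts to [G^`(1)], and any lift of an element that
    normalizes [K] normalizes the preimage of [K]. *)
Lemma morphim_norm_preim K : f @* 'N_(G^`(1))(preim_subgroup K) = 'N_(Gbar^`(1))(K).
Proof.
apply/eqP; rewrite eqEsubset; apply/andP; split.
  apply: subset_trans (morphim_subnorm _ _ _) _.
  by rewrite morphim_der // fG morphpreK ?sub_image_subgroup.
apply/subsetP=> y /setIP[]; rewrite -{1}fG -morphim_der // => /morphimP[x Gx G'x ->] nKfx.
apply: mem_morphim; rewrite // inE G'x.
by apply: (subsetP (morphpre_norm f K)); apply: mem_morphpre.
Qed.

Lemma morphim_der_cap_preim K : f @* (G^`(1) :&: preim_subgroup K) = Gbar^`(1) :&: K.
Proof.
rewrite morphimIG ?ker_sub_preim_subgroup // morphim_der // fG.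
by rewrite morphpreK ?sub_image_subgroup.
Qed.

(** Both groups meet the kernel of [f] in [G^`(1) :&: 'ker f], because the
    kernel lies in the preimage; so [f] does not change their index. *)
Lemma index_norm_der_preim K :
  #|'N_(G^`(1))(preim_subgroup K) : G^`(1) :&: preim_subgroup K|
    = #|'N_(Gbar^`(1))(K) : Gbar^`(1) :&: K|.
Proof.
rewrite -morphim_norm_preim -morphim_der_cap_preim.
rewrite -(index_morphim_ker f) ?setIS ?normG //; last first.
  exact: subset_trans (subsetIl _ _) (der_sub _ _).
rewrite [X in (_ * X)%N](_ : _ = 1%N) ?muln1 //; apply/eqP; rewrite indexg_eq1.
exact: setISS (subsetIl _ _) (ker_sub_preim_subgroup K).
Qed.

End HomomorphicImage.

(** The identity at [K] is the identity of [G] at the preimage of [K], term by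
    term. *)
Lemma mu_lambda_homg (gT rT : finGroupType) (G : {group gT}) (Gbar : {group rT}) :
  (Gbar \homg G)%g -> mu_lambda_property G -> mu_lambda_property Gbar.
Proof.
case/homgP=> f fG GP K.
rewrite -(group_mu_preim fG) -(group_lambda_preim fG).
by rewrite -(index_norm_der_preim fG); apply: GP.
Qed.

Theorem mainTheorem10 (gT rT : finGroupType) (Gbar : {group rT})
    (G N : {group gT}) :
  ~ mu_lambda_property Gbar ->
  (N <| G)%g -> (G / N \isog Gbar)%g ->
  ~ mu_lambda_property G.
Proof.
move=> notP nsNG isoGbar GP; apply: notP; apply: mu_lambda_homg GP.
apply: homg_trans (quotient_homg (normal_norm nsNG)).
by apply: isog_hom; rewrite isog_sym.
Qed.
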